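(* For every infinite abelian (discrete) group $G$ the ambit $(G,\beta G,p_e)$ does not have sep. fin. DRdeg.
   Context: $\beta G$ is the Stone space of all ultrafilters on $G$ with the left translation action $gp=\{gA:A\in p\}$ of the discrete group $G$, and $p_e$ is the principal ultrafilter at the identity $e$; $(G,\beta G,p_e)$ is a $0$-dimensional ambit (compact Hausdorff $0$-dimensional $G$-space with a distinguished point with dense orbit). For a $0$-dimensional ambit $(G,X,x_0)$ with algebra of clopen sets $\mathcal{B}$: a coloring is a function $c\colon G\to 2^n$, $n\ge 1$. For $\Sigma\subseteq\mathcal{B}$, $c$ is a definable $\Sigma$-coloring if there are $U_0,\dots,U_{n-1}\in\Sigma$ and $y_0,\dots,y_{n-1}\in Gx_0$ such that for all $g\in G$, $i<n$: $c(g)(i)=1$ if $y_i\in gU_i$ and $c(g)(i)=0$ if $y_i\notin gU_i$. The ambit has separately finite definable Ramsey degree (sep. fin. DRdeg) if for every finite $\Sigma\subseteq\mathcal{B}$ there is $l\ge 1$ such that for every definable $\Sigma$-coloring $c\colon G\to 2^n$ (any $n\geq 1$), every $k\ge 1$ and every $k$-element $A\subseteq G$, there is $h\in G$ with $|c[hA]|\le l$. *)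

(* Defs.v *)
From HB Require Import structures.
From mathcomp Require Import all_boot.
From mathcomp Require Import monoid.
From mathcomp Require Import boolp classical_sets functions cardinality filter.
From mathcomp Require Import topology.

Set Implicit Arguments.
Unset Strict Implicit.
Unset Printing Implicit Defensive.

Local Open Scope classical_set_scope.
Local Open Scope card_scope.
Local Open Scope group_scope.

(* Since the acting group is discrete, continuity of the action means that
   every g acts continuously. [basis clopen] is zero-dimensionality in the
   sense of a base of clopen sets; the library's [zero_dimensional] only says
   that clopen sets separate points. *)
Record ambit0 (G : groupType) := Ambit0 {
  ambit_space :> topologicalType;
  ambit_act : G -> ambit_space -> ambit_space;
  ambit_pt : ambit_space;
  ambit_act1 : forall x, ambit_act 1 x = x;
  ambit_actM : forall g h x,
    ambit_act (g * h) x = ambit_act g (ambit_act h x);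
  ambit_act_continuous : forall g, continuous (ambit_act g);
  ambit_compact : compact [set: ambit_space];
  ambit_hausdorff : hausdorff_space ambit_space;
  ambit_zero_dim : basis (@clopen ambit_space);
  ambit_dense_orbit : dense [set ambit_act g ambit_pt | g in [set: G]] }.

Section DefinableColorings.
Context {G : groupType} (X : ambit0 G).

Definition base_orbit : set X :=
  [set ambit_act g (ambit_pt X) | g in [set: G]].

Definition definable_coloring (Sigma : set (set X)) (n : nat)
    (c : G -> {ffun 'I_n -> bool}) : Prop :=
  exists (U : 'I_n -> set X) (y : 'I_n -> X),
    [/\ forall i, Sigma (U i),
        forall i, base_orbit (y i)
      & forall g i, c g i = (y i \in ambit_act g @` U i)].

Definition sep_fin_DRdeg : Prop :=
  forall Sigma : set (set X), finite_set Sigma -> Sigma `<=` clopen ->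
  exists l : nat, (1 <= l)%N /\
    forall (n : nat) (c : G -> {ffun 'I_n -> bool}),
      (1 <= n)%N -> definable_coloring Sigma c ->
    forall (k : nat) (A : set G), (1 <= k)%N -> A #= `I_k ->
    exists h : G, c @` [set h * a | a in A] #<= `I_l.

End DefinableColorings.

Record ultrafilter (T : Type) := Ultrafilter {
  ultra_sets :> set T -> Prop;
  ultra_setsP : UltraFilter ultra_sets }.

#[global] Existing Instance ultra_setsP.

HB.instance Definition _ (T : Type) := gen_eqMixin (ultrafilter T).
HB.instance Definition _ (T : Type) := gen_choiceMixin (ultrafilter T).

Section StoneSpace.
Context {T : Type}.
Implicit Types (p q : ultrafilter T) (A B : set T).

Lemma ultrafilter_eq p q : (forall A, p A -> q A) -> p = q.
Proof.
case: p q => [F UF] [H UH] /= FH.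
have E : H = F by apply: max_filter.
by subst H; congr Ultrafilter; exact: Prop_irrelevance.
Qed.

Lemma ultrafilterS p A B : A `<=` B -> p A -> p B.
Proof. exact: filterS. Qed.

Lemma ultrafilterI p A B : p A -> p B -> p (A `&` B).
Proof. exact: filterI. Qed.

Lemma ultrafilter_notC p A : p A -> ~ p (~` A).
Proof.
by move=> pA pnA; have [x []] := filter_ex (ultrafilterI pA pnA).
Qed.

Lemma ultrafilterC p A : p (~` A) <-> ~ p A.
Proof.
split=> [pnA pA|npA]; first exact: ultrafilter_notC pnA.
by have [] := in_ultra_setVsetC A (ultra_setsP p).
Qed.

Lemma proper_ultra (F : set_system T) : ProperFilter F ->
  (forall A, F A \/ F (~` A)) -> UltraFilter F.
Proof.
move=> PF FC; split=> // H PH FH; apply/seteqP; split=> // A HA.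
have [//|/FH HnA] := FC A.
by have [x []] := filter_ex (filterI HA HnA).
Qed.

Definition stone_base A : set (ultrafilter T) := [set p | p A].

Lemma stone_base_cover :
  \bigcup_(A in [set: set T]) stone_base A = [set: ultrafilter T].
Proof.
by apply/seteqP; split=> // p _; exists setT => //; exact: filterT.
Qed.

Lemma stone_base_join A B p : [set: set T] A -> [set: set T] B ->
  stone_base A p -> stone_base B p ->
  exists C, [/\ [set: set T] C, stone_base C p
    & stone_base C `<=` stone_base A `&` stone_base B].
Proof.
move=> _ _ pA pB; exists (A `&` B); split=> //; first exact: ultrafilterI.
by move=> q qAB; split; apply: ultrafilterS qAB => x [].
Qed.

End StoneSpace.

HB.instance Definition _ (T : Type) :=
  isBaseTopological.Build (ultrafilter T)
    (@stone_base_cover T) (@stone_base_join T).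

Section StoneTopology.
Context {T : Type}.
Implicit Types (p q : ultrafilter T) (A B : set T).

Lemma stone_base_open A : open (stone_base A).
Proof.
exists [set A] => //; apply/seteqP; split=> p; first by move=> [_ ->].
by exists A.
Qed.

Lemma stone_base_clopen A : clopen (stone_base A).
Proof.
split; first exact: stone_base_open.
rewrite -openC (_ : ~` _ = stone_base (~` A)); first exact: stone_base_open.
by apply/seteqP; split=> p /= /ultrafilterC.
Qed.

Lemma stone_openP (O : set (ultrafilter T)) p : open O -> O p ->
  exists A, p A /\ stone_base A `<=` O.
Proof.
by move=> [D _ <-] [A DA pA]; exists A; split=> // q qA; exists A.
Qed.

Lemma stone_nbhsP p (N : set (ultrafilter T)) :
  nbhs p N <-> exists A, p A /\ stone_base A `<=` N.
Proof.
rewrite nbhsE; split=> [[O [oO Op] ON]|[A [pA AN]]].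
  have [A [pA AO]] := stone_openP oO Op.
  by exists A; split=> //; exact: subset_trans ON.
by exists (stone_base A) => //; split=> //; exact: stone_base_open.
Qed.

Lemma stone_zero_dim : basis (@clopen (ultrafilter T)).
Proof.
split=> [O []//|p N /stone_nbhsP[A [pA AN]]].
by exists (stone_base A) => //; split=> //; exact: stone_base_clopen.
Qed.

Lemma stone_hausdorff : hausdorff_space (ultrafilter T).
Proof.
move=> p q pq; apply: ultrafilter_eq => A pA; apply: contrapT => nqA.
have [r [rA rnA]] : stone_base A `&` stone_base (~` A) !=set0.
  apply: pq; apply/stone_nbhsP; first by exists A; split.
  by exists (~` A); split=> //; apply/ultrafilterC.
exact: ultrafilter_notC rnA.
Qed.

Lemma stone_compact : compact [set: ultrafilter T].
Proof.
rewrite compact_ultra => F UF _.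
pose P : set_system T := [set A | F (stone_base A)].
have PF : ProperFilter P.
  split.
    move=> P0; have [p p0] := @filter_ex _ F _ _ P0.
    by have [x []] := @filter_ex _ p _ _ p0.
  split=> [|A B PA PB|A B AB].
  - rewrite /P /= (_ : stone_base _ = setT); first exact: filterT.
    by apply/seteqP; split=> // p _; exact: filterT.
  - by apply: (@filterS _ F) (@filterI _ F _ _ _ PA PB) => p [pA pB]; exact: ultrafilterI.
  - by apply: (@filterS _ F) => p; exact: ultrafilterS.
have UP : UltraFilter P.
  apply: proper_ultra => A.
  have [FA|FnA] := in_ultra_setVsetC (stone_base A) UF; first by left.
  by right; apply: (@filterS _ F) FnA => p /ultrafilterC.
exists (Ultrafilter UP); split=> // N /stone_nbhsP[A [PA AN]].
exact: (@filterS _ F) PA.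
Qed.

End StoneTopology.

Section BetaG.
Context (G : groupType).
Implicit Types (p : ultrafilter G) (g h : G).

Lemma mulg_surj g : [set g * x | x in [set: G]] = [set: G].
Proof.
by apply/seteqP; split=> // x _; exists (g^-1 * x) => //; exact: mulVKg.
Qed.

Definition beta_act g p : ultrafilter G :=
  Ultrafilter (ultra_image (ultra_setsP p) (mulg_surj g)).

Lemma beta_actE g p : ultra_sets (beta_act g p) =
  [set [set g * x | x in A] | A in ultra_sets p].
Proof. by []. Qed.

Definition beta_pt : ultrafilter G := Ultrafilter (principal_filter_ultra 1).

Lemma beta_act1 p : beta_act 1 p = p.
Proof.
apply: ultrafilter_eq => _ [A pA <-].
rewrite (_ : [set _ | _ in A] = A) //; apply/seteqP; split=> x.
  by move=> [y Ay <-]; rewrite mul1g.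
by exists x; rewrite ?mul1g.
Qed.

Lemma beta_actM g h p : beta_act (g * h) p = beta_act g (beta_act h p).
Proof.
apply: ultrafilter_eq => _ [A pA <-].
exists [set h * x | x in A]; first by exists A.
by rewrite image_comp; apply: eq_imagel => x _ /=; rewrite mulgA.
Qed.

Lemma beta_actP g p (A : set G) : beta_act g p A <-> p [set x | A (g * x)].
Proof.
split=> [[B pB <-]|pA]; first by apply: ultrafilterS pB => x Bx; exists x.
exists [set x | A (g * x)] => //; apply/seteqP; split=> x; first by case=> y ? <-.
by move=> Ax; exists (g^-1 * x); rewrite /= mulVKg.
Qed.

Lemma beta_act_continuous g : continuous (beta_act g).
Proof.
move=> p N /stone_nbhsP[A [pA AN]]; apply/stone_nbhsP.
exists [set x | A (g * x)]; split; first exact/beta_actP.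
by move=> q /beta_actP /AN.
Qed.

Lemma beta_dense_orbit : dense [set beta_act g beta_pt | g in [set: G]].
Proof.
move=> O [p Op] oO; have [A [pA AO]] := stone_openP oO Op.
have [g Ag] := filter_ex pA.
exists (beta_act g beta_pt); split; last by exists g.
by apply/AO/beta_actP/principal_filterP; rewrite /= mulg1.
Qed.

Definition beta_ambit : ambit0 G :=
  Ambit0 beta_act1 beta_actM beta_act_continuous (@stone_compact G)
    (@stone_hausdorff G) (@stone_zero_dim G) beta_dense_orbit.

End BetaG.

(* Main.v *)
Require Import Defs.
From mathcomp Require Import all_boot monoid order ssralg ssrnum ssrint intdiv.
From mathcomp Require Import boolp classical_sets functions cardinality filter.
From mathcomp Require Import zify.

(** A single clopen set [stone_base chi], for a well chosen [chi : G -> bool],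
already refutes separate finiteness. With parameters [y_0, ..., y_(n-1)] in the
orbit of the base point it yields the coloring
[g |-> (chi (g^-1 * y_i))_(i < n)]. Say that [chi] blocks [s] if some finite [Y]
witnesses, uniformly in [u], that the translates of [chi] by [u] and by [u * s]
differ on [Y]. If [chi] blocks [x_i^-1 * x_j] for all [i < j <= l], take for the
[y_i] all the witnesses involved. Since [G] is abelian, the coloring is then
injective on every translate of [A = {x_0^-1, ..., x_l^-1}], so [l] colors do
not suffice ([blocks_not_sep_fin_DRdeg]). It remains to find one [chi] and an
infinite sequence [x] such that all these quotients are blocked.

If [z] has infinite order, then [x_i = z ^+ i] works. Let [phi : G -> Z] turn
multiplication by [z] into adding [1], and let [chi g] be the parity of the
2-adic valuation of [phi g], the period doubling coloring of each coset of
[<z>]. In any window of length [4 * 2 ^ v(d)] there is an [m] such that the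
valuations of [m] and of [m + d] are [v(d)] and [v(d) + 1]
([blocks_infinite_order]).

If [G] is torsion, it contains finite subgroups [H_0 < H_1 < ...] such that
[#|H_(n+1)| > 2 #|H_n|]. Mark one [H_n]-coset inside each [H_(n+1)]-coset, and
let [chi] count, modulo 2, the [n] for which the [H_n]-coset of a point is
marked (relative to a fixed point in the same coset of the union of the [H_n],
which makes the count finite: [parity_limit]). Let [S_n] be the sum of
[(-1) ^ chi] over an [H_n]-coset, taken with the first [n] marks only. Passing from [H_n] to [H_(n+1)] flips the sign on one
of the [r = #|H_(n+1)| / #|H_n|] cosets, so [S_(n+1) = (r - 2) S_n]. Hence
[S_n] does not depend on the coset and is never [0] ([parity_sum]). A period of
[chi] on an [H_(n+1)]-coset that is not in [H_n] would carry the marked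
[H_n]-coset to an unmarked one and give [S_n = - S_n]. So every period lies in
[H_n], and by descent in [H_0] ([parity_aperiodic]). Thus [chi] blocks every
element of the union of the [H_n] outside [H_0], with [Y = H_n]
([blocks_chain]), and any [x_i] in [H_(i+1)] but not in [H_i] will do. *)

Import GRing.Theory.

Local Open Scope classical_set_scope.
Local Open Scope card_scope.
Local Open Scope group_scope.

(** * Blocking and definable colorings *)

(** Requiring [Y] to be independent of [u] makes this a condition on the whole
orbit closure of [chi]: [s] fixes none of its points. The terminology is that
of Gao, Jackson and Seward, whose 2-colorings block every [s <> 1]. *)
Definition blocks {G : groupType} (chi : G -> bool) (s : G) : Prop :=
  exists Y : seq G,
    forall u, exists2 y, y \in Y & chi (u * y) != chi (u * s * y).

(** The point [y i] of the orbit is the principal ultrafilter at [y i], and it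
lies in [g U] exactly when the set that defines [U] contains [g^-1 * y i]. *)
Lemma definable_coloring_beta {G : groupType} (chi : G -> bool) (n : nat)
    (y : 'I_n -> G) :
  @definable_coloring G (beta_ambit G) [set stone_base chi] n
    (fun g => [ffun i => chi (g^-1 * y i)]).
Proof.
exists (fun=> stone_base chi), (fun i => beta_act (y i) (beta_pt G)).
split=> // [i|g i]; first by exists (y i).
rewrite ffunE; apply/idP/idP => [chi_y|/set_mem[p p_chi gpE]].
  apply/mem_set; exists (beta_act (g^-1 * y i) (beta_pt G)).
    by apply/beta_actP/principal_filterP; rewrite /= mulg1.
  by rewrite /= -beta_actM mulVKg.
have pE : p = beta_act (g^-1 * y i) (beta_pt G).
  by rewrite beta_actM -gpE /= -beta_actM mulVg beta_act1.
move: p_chi; rewrite /stone_base /= pE.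
by move=> /beta_actP/principal_filterP; rewrite /= mulg1.
Qed.

(** The inverse in the definable coloring turns the right translates [h * x^-1]
into left translates of [x]; commutativity then brings [x i] and [x j] next to
each other, so that only [(x i)^-1 * x j] has to be blocked. *)
Lemma blocks_not_sep_fin_DRdeg {G : groupType} (chi : G -> bool)
    (x : nat -> G) :
  (forall u v : G, u * v = v * u) ->
  (forall i j, (i < j)%N -> blocks chi ((x i)^-1 * x j)) ->
  ~ sep_fin_DRdeg (beta_ambit G).
Proof.
move=> mulC chi_x drd.
have [|_ ->|l [l_gt0 /=]] := drd [set stone_base chi]; first exact: finite_set1.
  exact: stone_base_clopen.
have /choice[Y Yx] (p : nat * nat) : exists Y : seq G, (p.1 < p.2)%N ->
    forall u, exists2 y, y \in Y &
      chi (u * y) != chi (u * ((x p.1)^-1 * x p.2) * y).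
  have [/chi_x[Y ?]|_] := ltnP p.1 p.2; first by exists Y.
  by exists [::].
(* The witnesses for all pairs [i, j <= l] together separate [x i] from [x j]. *)
pose s := flatten [seq Y (i, j) | i <- iota 0 l.+1, j <- iota 0 l.+1].
have s_sep i j t : (i < j <= l)%N ->
    exists2 y, y \in s & chi (x i * t * y) != chi (x j * t * y).
  move=> /andP[ij jl].
  have [y yY chiy] := Yx (i, j) ij (x i * t); exists y.
    apply/flattenP; exists (Y (i, j)) => //; apply/allpairsP; exists (i, j).
    by rewrite !mem_iota /= add0n !ltnS jl (leq_trans (ltnW ij) jl).
  move: chiy => /=; rewrite (_ : x i * t * (_ * _) = x j * t) //.
  by rewrite (mulC (x i)) -mulgA mulVKg mulC.
pose c g := [ffun i : 'I_(size s) => chi (g^-1 * tnth (in_tuple s) i)].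
have s_gt0 : (0 < size s)%N.
  by have [//|y] := s_sep 0%N 1%N 1; case: (s).
have c_inj h i j : (i < j <= l)%N -> c (h * (x i)^-1) <> c (h * (x j)^-1).
  move=> ij; have [y ys /eqP chiy /ffunP cE] := s_sep i j h^-1 ij; apply: chiy.
  have ys' : (index y s < size s)%N by rewrite index_mem.
  have := cE (Ordinal ys').
  by rewrite !ffunE !(tnth_nth 1) /= nth_index // !invgM !invgK.
move=> /(_ _ c s_gt0 (definable_coloring_beta _ _ _)).
pose f h i := c (h * (x i)^-1).
have f_inj h : {in `I_l.+1 &, injective (f h)}.
  move=> i j /set_mem/= il /set_mem/= jl; rewrite /f.
  case: (ltngtP i j) => // ij fE; exfalso.
    by apply: (c_inj h i j) fE; rewrite ij.
  by apply: (c_inj h j i) (esym fE); rewrite ij.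
move=> /(_ l.+1 [set (x i)^-1 | i in `I_l.+1] isT) [].
  apply: inj_card_eq => i j /(f_inj 1) fi /fi{}fi xij.
  by apply: fi; rewrite /f xij.
move=> h; rewrite !image_comp => /= fl.
have /card_esym := inj_card_eq (f_inj h).
by move=> /(card_le_eql (C:=`I_l)); rewrite fl card_le_II ltnn.
Qed.

(** * Canonical representatives of cosets *)

Definition subgroup_pred {G : groupType} (P : pred G) : Prop :=
  P 1 /\ forall x y, P x -> P y -> P (x^-1 * y).

(** [choose] depends only on the extension of its predicate, here the coset
[u P], so the same point is selected for all [u] in one coset. *)
Definition coset_rep {G : groupType} (P : pred G) (u : G) : G :=
  choose (fun v => P (u^-1 * v)) u.

Lemma coset_repP {G : groupType} (P : pred G) (u : G) :
  subgroup_pred P -> P (u^-1 * coset_rep P u).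
Proof.
by case=> P1 _; apply: (@chooseP _ (fun v => P (u^-1 * v))); rewrite mulVg.
Qed.

Lemma coset_repM {G : groupType} (P : pred G) (u h : G) :
  subgroup_pred P -> P h -> coset_rep P (u * h) = coset_rep P u.
Proof.
case=> P1 PV Ph; rewrite /coset_rep.
have PE : (fun v => P ((u * h)^-1 * v)) =1 (fun v => P (u^-1 * v)).
  move=> v; rewrite /= invgM -mulgA; apply/idP/idP; last exact: PV.
  have PhV : P h^-1 by rewrite -[h^-1]mulg1 PV.
  by move=> /(PV _ _ PhV); rewrite mulKg.
by rewrite (eq_choose PE); apply: choose_id; rewrite ?mulKg ?mulVg.
Qed.

(** * Elements of infinite order *)

Lemma logn2_pow2_mul_odd (k : nat) (q : int) :
  logn 2 `|((2 ^ k)%N%:Z * (1 + 2 * q))%R|%N = k.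
Proof.
have q_odd : odd `|(1 + 2 * q)%R|%N by lia.
rewrite abszM absz_nat lognM ?expn_gt0 ?(odd_gt0 q_odd) // pfactorK //.
by rewrite [X in (_ + X)%N](_ : _ = 0%N) ?addn0 // lognE dvdn2 q_odd /= andbF.
Qed.

Definition period_doubling (m : int) : bool := odd (logn 2 `|m|%N).

(** Write [d = 2 ^ k * w] with [w] odd. Among [4 * 2 ^ k] consecutive integers
one is congruent to [2 ^ k * (2 - w)] modulo [4 * 2 ^ k]. It has valuation [k],
and adding [d] gives [2 * 2 ^ k] modulo [4 * 2 ^ k], of valuation [k + 1]. *)
Lemma period_doubling_shift (d : nat) (a : int) : (0 < d)%N ->
  exists2 j, (j < 2 ^ (logn 2 d).+2)%N &
    period_doubling (a + j%:Z)%R != period_doubling (a + (j + d)%:Z)%R.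
Proof.
move=> d_gt0; set k := logn 2 d.
have [w w_odd dE] := pfactor_coprime (isT : prime 2) d_gt0; rewrite -/k in dE.
rewrite coprime2n in w_odd.
have [v wE] : exists v, w = (1 + 2 * v)%N by exists w./2; lia.
pose P := (2 ^ k)%N; have P_gt0 : (0 < P)%N by rewrite expn_gt0.
have N_E : (2 ^ k.+2 = 4 * P)%N by rewrite !expnS mulnA.
pose b := (2 * P%:Z - d%:Z - a)%R; pose q := (b %/ (4 * P)%N%:Z)%Z.
have N_neq0 : ((4 * P)%N%:Z != 0)%R by lia.
have bE : b = (q * (4 * P)%N%:Z + (b %% (4 * P)%N%:Z)%Z)%R := divz_eq _ _.
have b_ge0 := modz_ge0 b N_neq0.
have b_lt : ((b %% (4 * P)%N%:Z)%Z < (4 * P)%N%:Z)%R by apply: ltz_pmod; lia.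
exists `|(b %% ((4 * P)%N : int))%Z|%N; first by rewrite N_E; lia.
set j := `|_|%N; have jE : (j%:Z = b - q * (4 * P)%N%:Z)%R by lia.
have -> : (a + j%:Z)%R = ((2 ^ k)%N%:Z * (1 + 2 * (- v%:Z - 2 * q)))%R.
  by rewrite jE /b dE wE -/P; lia.
have -> : (a + (j + d)%:Z)%R = ((2 ^ k.+1)%N%:Z * (1 + 2 * (- q)))%R.
  by rewrite PoszD jE /b expnS -/P; lia.
by rewrite /period_doubling !logn2_pow2_mul_odd oddS; case: odd.
Qed.

(** Choosing a representative in each coset of [<z>] identifies the coset with
the integers. *)
Lemma exists_exponent {G : groupType} (z : G) :
  (forall n, (0 < n)%N -> z ^+ n <> 1) ->
  exists phi : G -> int, forall g n, phi (g * z ^+ n) = (phi g + n%:Z)%R.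
Proof.
move=> z_inf.
(* [P] is [<z>]; two exponents in nat express an integer exponent. *)
pose P x := `[< exists i j, x * z ^+ i = z ^+ j >].
have subP : subgroup_pred P.
  split=> [|x y /asboolP[i [j xE]] /asboolP[i' [j' yE]]]; apply/asboolP.
    by exists 0%N, 0%N; rewrite mul1g.
  exists (i' + j)%N, (i + j')%N; rewrite expgnDr -!mulgA [y * _]mulgA yE.
  by rewrite -expgnDr addnC expgnDr -xE -mulgA mulKg expgnDr.
have /choice[phi phiP] g : exists m : int, exists i j,
    g * z ^+ i = coset_rep P g * z ^+ j /\ m = (j%:Z - i%:Z)%R.
  have /asboolP[j [i E]] := coset_repP P g subP.
  by exists (j%:Z - i%:Z)%R, i, j; rewrite -E -mulgA mulVKg.
exists phi => g n.
have rhoE : coset_rep P (g * z ^+ n) = coset_rep P g.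
  by apply: coset_repM => //; apply/asboolP; exists 0%N, n; rewrite mulg1.
have [i [j [E ->]]] := phiP g; have [i' [j' [E' ->]]] := phiP (g * z ^+ n).
have z_inj a b : (a < b)%N -> z ^+ a <> z ^+ b.
  move=> ab /esym; rewrite -(subnKC (ltnW ab)) expgnDr.
  by rewrite -[RHS]mulg1 => /mulgI; apply: z_inf; rewrite subn_gt0.
have {z_inj}z_inj a b : z ^+ a = z ^+ b -> a = b.
  by case: (ltngtP a b) => // /z_inj ab // /esym.
suff : (j + n + i')%N = (j' + i)%N by lia.
apply: z_inj; apply: (mulgI (coset_rep P g)).
move: E'; rewrite rhoE => E'.
rewrite (expgnDr z j') mulgA -E' -!mulgA -!expgnDr.
rewrite -addnA (expgnDr z j) mulgA -E -mulgA -expgnDr.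
by congr (_ * _ ^+ _); lia.
Qed.

Lemma blocks_infinite_order {G : groupType} (z : G) :
  (forall n, (0 < n)%N -> z ^+ n <> 1) ->
  exists chi : G -> bool, forall d, (0 < d)%N -> blocks chi (z ^+ d).
Proof.
move=> /exists_exponent[phi phiD].
exists (period_doubling \o phi) => d d_gt0.
exists [seq z ^+ j | j <- iota 0 (2 ^ (logn 2 d).+2)] => u.
have [j jN jd] := period_doubling_shift d (phi u) d_gt0.
exists (z ^+ j); first by apply: map_f; rewrite mem_iota.
by rewrite /= -mulgA -expgnDr !phiD addnC.
Qed.

(** * Finite subgroups *)

Definition finite_subgroup {G : groupType} (H : seq G) : Prop :=
  [/\ uniq H, 1 \in H & {in H &, forall x y, x^-1 * y \in H}].

Section FiniteSubgroup.
Context {G : groupType} {H : seq G} (subH : finite_subgroup H).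
Implicit Types x y : G.

Lemma fsubg_uniq : uniq H. Proof. by case: subH. Qed.

Lemma fsubg1 : 1 \in H. Proof. by case: subH. Qed.

Lemma fsubgV x : x \in H -> x^-1 \in H.
Proof. by case: subH => _ H1 HV xH; rewrite -[x^-1]mulg1 HV. Qed.

Lemma fsubgMl x y : x \in H -> (x * y \in H) = (y \in H).
Proof.
case: subH => _ _ HV xH; apply/idP/idP => [xyH|yH].
  by rewrite -[y](mulKg x) HV.
by rewrite -[x]invgK HV // fsubgV.
Qed.

Lemma fsubgMr x y : y \in H -> (x * y \in H) = (x \in H).
Proof.
move=> yH; apply/idP/idP => [xyH|xH]; last by rewrite fsubgMl.
by rewrite -[x](mulgK y) fsubgMl // fsubgV.
Qed.

Lemma fsubg_pred : subgroup_pred (mem H).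
Proof. by case: subH => _ H1 HV; split=> // x y; exact: HV. Qed.

Lemma fsubg_size_gt0 : (0 < size H)%N.
Proof. by have := fsubg1; case: (H). Qed.

Lemma sum_fsubgMr (f : G -> int) x : x \in H ->
  (\sum_(h <- H) f (h * x)%g = \sum_(h <- H) f h)%R.
Proof.
move=> xH; rewrite -(big_map (fun h => h * x) xpredT f).
apply/perm_big/uniq_perm; rewrite ?fsubg_uniq //.
  by rewrite map_inj_uniq ?fsubg_uniq //; exact: mulIg.
move=> h; apply/mapP/idP => [[k kH ->]|hH]; first by rewrite fsubgMr.
by exists (h / x); rewrite ?mulgVK // fsubgMr // fsubgV.
Qed.

End FiniteSubgroup.

Section Chain.
Context {G : groupType}.
Implicit Types (H K : seq G) (u v w x y z : G).

Lemma sum_const_seq (T : Type) (r : seq T) (c : int) :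
  (\sum_(i <- r) c = (size r)%:Z * c)%R.
Proof. by rewrite big_const_seq count_predT iter_addr_0 -mulr_natl natz. Qed.

Lemma sum_coset H K (f : G -> int) m :
  finite_subgroup H -> finite_subgroup K -> {subset H <= K} -> m \in K ->
  (\sum_(h <- K | (m^-1 * h)%g \in H) f h = \sum_(h <- H) f (m * h)%g)%R.
Proof.
move=> sH sK HK mK.
rewrite -(big_map (fun h => m * h) xpredT f) -[LHS]big_filter.
apply/perm_big/uniq_perm; first by rewrite filter_uniq ?fsubg_uniq.
  by rewrite map_inj_uniq ?fsubg_uniq //; exact: mulgI.
move=> h; rewrite mem_filter; apply/andP/mapP => [[hH hK]|[k kH ->]].
  by exists (m^-1 * h); rewrite ?mulVKg.
by rewrite mulKg fsubgMl // HK.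
Qed.

(** In the abelian case the powers of [z] times [H] already form a subgroup. *)
Lemma fsubg_adjoin H z (n : nat) :
  (forall u v, u * v = v * u) -> finite_subgroup H -> (0 < n)%N -> z ^+ n = 1 ->
  exists K, [/\ finite_subgroup K, {subset H <= K} & z \in K].
Proof.
move=> mulC sH n_gt0 zn.
pose K := undup [seq h * z ^+ i | h <- H, i <- iota 0 n].
have KP x : x \in K <-> exists h i, h \in H /\ x = h * z ^+ i.
  rewrite mem_undup; split=> [/allpairsP[[h i] /= [hH _ ->]]|[h [i [hH ->]]]].
    by exists h, i.
  apply/allpairsP; exists (h, (i %% n)%N).
  rewrite mem_iota ltn_mod /=; split=> //.
  by rewrite {1}(divn_eq i n) expgnDr mulnC expgnA zn expg1n mul1g.
exists K; split.
- split; first exact: undup_uniq.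
    by apply/KP; exists 1, 0%N; rewrite fsubg1 // expg0 mulg1.
  move=> _ _ /KP[h [i [hH ->]]] /KP[k [j [kH ->]]].
  apply/KP; exists (h^-1 * k), (i * n.-1 + j)%N; split.
    by rewrite fsubgMl // fsubgV.
  have ziV : (z ^+ i)^-1 = z ^+ (i * n.-1).
    apply: mulg1_eq; rewrite -expgnDr -mulnS prednK // mulnC.
    by rewrite expgnA zn expg1n.
  rewrite invgM ziV (mulC _ h^-1) expgnDr -!mulgA; congr (_ * _).
  by rewrite !mulgA (mulC _ k).
- by move=> h hH; apply/KP; exists h, 0%N; rewrite expg0 mulg1.
- by apply/KP; exists 1, 1%N; rewrite fsubg1 // expg1 mul1g.
Qed.

Lemma fsubg_size_double H K z :
  finite_subgroup H -> finite_subgroup K -> {subset H <= K} ->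
  z \in K -> z \notin H -> (2 * size H <= size K)%N.
Proof.
move=> sH sK HK zK zH; rewrite mul2n -addnn -{2}(size_map ( *%g z) H) -size_cat.
apply: uniq_leq_size; last first.
  move=> x; rewrite mem_cat => /orP[/HK //|/mapP[h hH ->]].
  by rewrite fsubgMr // HK.
rewrite cat_uniq fsubg_uniq // map_inj_uniq ?fsubg_uniq //; last exact: mulgI.
rewrite andbT; apply/hasPn => _ /mapP[h hH ->].
by rewrite /= fsubgMr.
Qed.

(** The factor 2 is what keeps the coset sums [S_(n+1) = (r - 2) S_n] of signs
away from zero; growth by exactly 2 would not do. *)
Definition fast_chain (H : nat -> seq G) : Prop :=
  [/\ forall n, finite_subgroup (H n), forall n, {subset H n <= H n.+1}
    & forall n, (2 * size (H n) < size (H n.+1))%N].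

Lemma fast_chain_le (H : nat -> seq G) :
  fast_chain H -> forall n m, (n <= m)%N -> {subset H n <= H m}.
Proof.
case=> _ HS _ n m /subnKC <-; elim: (m - n)%N => [|k IHk] x.
  by rewrite addn0.
by rewrite addnS => /IHk/HS.
Qed.

Lemma exists_fast_chain :
  (forall u v, u * v = v * u) -> infinite_set [set: G] ->
  (forall z, exists2 n, (0 < n)%N & z ^+ n = 1) ->
  exists H : nat -> seq G, fast_chain H.
Proof.
move=> mulC Ginf tors.
(* One new element at least doubles [H]; adjoining two makes the growth strict. *)
have step H : finite_subgroup H -> exists K,
    [/\ finite_subgroup K, {subset H <= K} & (2 * size H <= size K)%N].
  move=> sH; have [z zH] : exists z, z \notin H.
    apply: contrapT => /forallNP HT; apply: Ginf.
    apply/finite_seqP; exists H; apply/seteqP; split=> // z _ /=.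
    exact/negPn/negP/HT.
  have [n n_gt0 zn] := tors z.
  have [K [sK HK zK]] := fsubg_adjoin _ _ _ mulC sH n_gt0 zn.
  by exists K; split=> //; apply: fsubg_size_double zH.
have /choice[next nextP] H : exists K, finite_subgroup H ->
    [/\ finite_subgroup K, {subset H <= K} & (2 * size H < size K)%N].
  have [/step[K [sK HK szK]]|] := pselect (finite_subgroup H); last by exists H.
  have [L [sL KL szL]] := step _ sK.
  exists L => sH; split=> // [x /HK/KL //|].
  by have := fsubg_size_gt0 sH; lia.
exists (fun n => iter n next [:: 1]).
have sH n : finite_subgroup (iter n next [:: 1]).
  elim: n => [|n /nextP[]//].
  split=> [||x y]; rewrite /= ?inE // => /eqP-> /eqP->.
  by rewrite mulVg.
by split=> // n; have [] := nextP _ (sH n).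
Qed.

End Chain.

(** * Marked cosets in a torsion group *)

Section MarkedCosets.
Context {G : groupType} (H : nat -> seq G) (chainH : fast_chain H).
Implicit Types (u v w x y z h : G) (n k : nat).

Let sH n : finite_subgroup (H n). Proof. by case: chainH. Qed.

Let HS n : {subset H n <= H n.+1}. Proof. by case: chainH. Qed.

Let H_le := fast_chain_le _ chainH.

(** Inside [u H_(n+1)], the coset [v H_n] of the canonical representative [v]
is the marked one. *)
Definition mark n u : bool := (coset_rep (mem (H n.+1)) u)^-1 * u \in H n.

Lemma markP n w : exists2 m, m \in H n.+1 &
  {in H n.+1, forall h, mark n (w * h) = (m^-1 * h \in H n)}.
Proof.
have subP := fsubg_pred (sH n.+1).
exists (w^-1 * coset_rep (mem (H n.+1)) w); first exact: coset_repP.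
by move=> h hH; rewrite /mark coset_repM // invgM invgK mulgA.
Qed.

Lemma markM n u h : h \in H n -> mark n (u * h) = mark n u.
Proof.
move=> hH; have [m mH mE] := markP n u.
rewrite mE ?HS // -[u in RHS]mulg1 mE; last exact: fsubg1.
by rewrite fsubgMr // mulg1.
Qed.

Fixpoint parity n u : bool :=
  if n is k.+1 then parity k u (+) mark k u else false.

(** The marks at levels [k >= n] are constant on [H n]-cosets, so they change
[parity] there only by a global flip. *)
Lemma parityB n m u h : (n <= m)%N -> h \in H n ->
  parity m (u * h) (+) parity m u = parity n (u * h) (+) parity n u.
Proof.
move=> /subnKC <- hH; elim: (m - n)%N => [|k IHk]; first by rewrite addn0.
rewrite addnS /= markM; last exact: H_le (leq_addr _ _) _ hH.
by rewrite -IHk addbACA addbb addbF.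
Qed.

Definition sign_of (b : bool) : int := ((-1) ^+ b)%R.

(** The recursion is used as [#|H_n| S_(n+1) = (#|H_(n+1)| - 2 #|H_n|) S_n].
This form needs no decomposition into cosets: averaging over translations by
[H_n] replaces it. *)
Lemma parity_sum n : exists2 s : int, s != 0%R &
  forall u, (\sum_(h <- H n) sign_of (parity n (u * h)%g) = s)%R.
Proof.
elim: n => [|n [s s_neq0 sE]].
  exists (size (H 0%N)) => [|u /=]; last by rewrite sum_const_seq mulr1.
  by have := fsubg_size_gt0 (sH 0); lia.
pose S u := (\sum_(h <- H n.+1) sign_of (parity n.+1 (u * h)%g))%R.
have SE u : ((size (H n))%:Z * S u =
    ((size (H n.+1))%:Z - 2 * (size (H n))%:Z) * s)%R.
  have [m mH mE] := markP n u.
  pose f h := sign_of (parity n (u * h)).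
  have coset_f v : (\sum_(h <- H n) f (v * h)%g = s)%R.
    by rewrite -(sE (u * v)); apply: eq_bigr => h _; rewrite /f mulgA.
  have S_split : (S u = \sum_(h <- H n.+1) f h -
      2 * \sum_(h <- H n.+1 | (m^-1 * h)%g \in H n) f h)%R.
    rewrite [X in (2 * X)%R]big_mkcond mulr_sumr -sumrB.
    apply: eq_big_seq => h hK; rewrite /f /= mE // /sign_of.
    by case: (_ \in _); case: parity.
  have average : ((size (H n))%:Z * \sum_(h <- H n.+1) f h
      = (size (H n.+1))%:Z * s)%R.
    transitivity (\sum_(k <- H n) \sum_(h <- H n.+1) f (h * k)%g)%R.
      rewrite -sum_const_seq; apply: eq_big_seq => k kH.
      by rewrite sum_fsubgMr // HS.
    rewrite exchange_big -sum_const_seq; apply: eq_bigr => h _ /=.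
    exact: coset_f.
  rewrite S_split sum_coset // coset_f; lia.
have szH := fsubg_size_gt0 (sH n).
have szHS : (2 * size (H n) < size (H n.+1))%N by case: chainH.
exists (S 1) => [|u].
  by apply/eqP => S0; have := SE 1; rewrite S0; nia.
have := SE u; rewrite -(SE 1) => /mulfI; apply; lia.
Qed.

(** A period [s] outside [H_n] moves the marked [H_n]-coset to an unmarked one,
where the mark no longer flips the sign; the coset sum would equal its own
opposite. *)
Lemma parity_aperiodic n w s : (forall u v, u * v = v * u) -> s \in H n ->
  {in H n, forall h, parity n (w * h * s) = parity n (w * h)} -> s \in H 0%N.
Proof.
move=> mulC; elim: n w s => // n IHn w s sHn per.
have [m mH mE] := markP n w.
have [sH'|sNH] := boolP (s \in H n).
  apply: (IHn w) => // h hH; have := per h (HS _ _ hH).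
  by rewrite /= markM // => /addIb.
have [t t_neq0 tE] := parity_sum n.
suff : (t = - t)%R by lia.
rewrite -{1}(tE (w * m * s)) -(tE (w * m)) -sumrN; apply: eq_big_seq => h hH.
have mhH : m * h \in H n.+1 by rewrite fsubgMl // HS.
have mhsH : m * h * s \in H n.+1 by rewrite fsubgMr.
have := per _ mhH; rewrite /= -(mulgA w (m * h)) !mE //.
rewrite -[m * h * s]mulgA !mulKg hH fsubgMl // (negbTE sNH) addbF.
rewrite -!mulgA (mulC h s) => ->.
by rewrite /sign_of addbT; case: parity.
Qed.

(** The number of marks at a point may be infinite. Counting relative to the
representative of its coset modulo the union of the [H_n] makes the total
finite, since the point and the representative share all marks from some level
on. *)
Lemma parity_limit : exists chi : G -> bool, forall n w, exists c,
  {in H n, forall h, chi (w * h) = parity n (w * h) (+) c}.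
Proof.
pose P x := `[< exists n, x \in H n >].
have PH n h : h \in H n -> P h by move=> hH; apply/asboolP; exists n.
have subP : subgroup_pred P.
  split=> [|x y /asboolP[i xH] /asboolP[j yH]]; first exact/(PH 0%N)/fsubg1.
  have {}xH := H_le _ _ (leq_maxl i j) _ xH.
  have {}yH := H_le _ _ (leq_maxr i j) _ yH.
  by apply: (PH (maxn i j)); rewrite fsubgMl // fsubgV.
pose rho := coset_rep P.
have rhoM n u h : h \in H n -> rho (u * h) = rho u.
  by move=> /PH; exact: coset_repM.
have /choice[M MP] u : exists n, u^-1 * rho u \in H n.
  exact: (asboolP _ (coset_repP P u subP)).
pose chi u := parity (M u) u (+) parity (M u) (rho u).
have chiE u k : (M u <= k)%N -> chi u = parity k u (+) parity k (rho u).
  move=> Mk; have := parityB _ _ u _ Mk (MP u).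
  by rewrite mulVKg addbC => ->; rewrite addbC.
exists chi => n w; exists (parity n w (+) chi w) => h hH.
pose k := maxn n (maxn (M w) (M (w * h))).
rewrite !(chiE _ k) /k ?leq_max ?leqnn ?orbT // (rhoM _ _ _ hH) -/k.
have := parityB n k w h (leq_maxl _ _) hH.
move: (parity k _) (parity k _) (parity k _) (parity n _) (parity n _).
by do 5!case.
Qed.

Lemma blocks_chain : (forall u v, u * v = v * u) ->
  exists chi : G -> bool,
    forall n s, s \in H n -> s \notin H 0%N -> blocks chi s.
Proof.
move=> mulC; have [chi chiP] := parity_limit; exists chi => n s sHn sH0.
exists (H n) => u; apply: contrapT => per.
move/negP: sH0; apply; apply: (parity_aperiodic n u) => // h hH.
have [c cE] := chiP n u; apply: (@addIb c); rewrite -mulgA -!cE ?fsubgMl //.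
apply/eqP/negPn/negP => chi_h; apply: per; exists h => //.
by rewrite eq_sym -mulgA (mulC s).
Qed.

End MarkedCosets.

(** * The theorem *)

Theorem proposition3p36 (G : groupType) :
  (forall x y : G, x * y = y * x) ->
  infinite_set [set: G] ->
  ~ sep_fin_DRdeg (beta_ambit G).
Proof.
move=> mulC Ginf.
have [tors|/existsNP[z z_inf]] :=
    pselect (forall z : G, exists2 n, (0 < n)%N & z ^+ n = 1); last first.
  have [n n_gt0 zn|chi chiP] := blocks_infinite_order z.
    by apply: z_inf; exists n.
  apply: (blocks_not_sep_fin_DRdeg chi (fun i => z ^+ i)) => // i j ij.
  by rewrite -(subnKC (ltnW ij)) expgnDr mulKg; apply: chiP; rewrite subn_gt0.
have [H chainH] := exists_fast_chain mulC Ginf tors.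
have [chi chiP] := blocks_chain H chainH mulC.
have [sH HS szH] := chainH.
have H_le := fast_chain_le H chainH.
have /choice[x xP] n : exists x, x \in H n.+1 /\ x \notin H n.
  apply: contrapT => /forallNP HSH.
  have := szH n; rewrite ltnNge => /negP; apply.
  apply: leq_trans (leq_pmull _ _) => //; apply: uniq_leq_size => [|y yH].
    exact: fsubg_uniq.
  by apply/negPn/negP => yNH; apply: (HSH y).
apply: (blocks_not_sep_fin_DRdeg chi x) => // i j ij.
have [[xi _] [xj xjN]] := (xP i, xP j).
apply: (chiP j.+1).
  by rewrite fsubgMl //; apply: fsubgV => //; apply: H_le xi; rewrite ltnS ltnW.
apply: contra xjN => xH0; rewrite -(mulVKg (x i) (x j)) fsubgMl //.
  exact: H_le xH0.
exact: H_le xi.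
Qed.
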